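(* Let $(p,q)$ be a non-strict pair of distinct points in a normed plane $(\mathbb{R}^2,\|\cdot\|)$, and let $G_t$ be the translate of the line $\langle p,q\rangle$ through the point $s_t$ defined in the context. Then every translate $G$ of $\langle p,q\rangle$ that lies above $\langle p,q\rangle$ and not above $G_t$ intersects $\operatorname{bis}(p,q)$ in exactly one point.
   Context: $(\mathbb{R}^2,\|\cdot\|)$ is an arbitrary two-dimensional real normed space (no strict convexity or smoothness assumed) with unit ball $B=\{x:\|x\|\le 1\}$ and unit circle $\operatorname{bd}(B)$. The bisector of $p\neq q$ is $\operatorname{bis}(p,q)=\{z\in\mathbb{R}^2:\|z-p\|=\|z-q\|\}$. The pair $(p,q)$ is called strict if $\operatorname{bd}(B)$ contains no (nondegenerate) line segment parallel to $p-q$; otherwise it is non-strict. For distinct $x,y$: $\langle x,y\rangle=\{\lambda y+(1-\lambda)x:\lambda\in\mathbb{R}\}$ (line), $[x,y\rangle=\{\lambda y+(1-\lambda)x:\lambda\ge 0\}$ (ray from $x$ through $y$). Orientation: one of the two sides of the line $\langle p,q\rangle$ is called ''above'', the other ''below'' (i.e. fix a nonzero linear functional $\psi$ with $\psi(p-q)=0$ and let ''above'' mean strictly larger $\psi$; a translate of $\langle p,q\rangle$ is a level set of $\psi$, and one translate is above another if its $\psi$-value is strictly larger). On lines parallel to $\langle p,q\rangle$, ''left to right'' is the direction of $q-p$. Points: let $L_{\text{top}}$ be the common supporting line of $p+B$ and $q+B$ that is parallel to $\langle p,q\rangle$ and lies above it. Write $L_{\text{top}}\cap(\operatorname{bd}(B)+p)=[t_p,t_p']$,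 where $t_p$ is the left and $t_p'$ the right endpoint, and $L_{\text{top}}\cap(\operatorname{bd}(B)+q)=[t_q',t_q]$, where $t_q'$ is the left and $t_q$ the right endpoint. Let $s_t$ be the intersection point of the rays $[p,t_p'\rangle$ and $[q,t_q'\rangle$. *)

(* Defs.v *)
From HB Require Import structures.
From mathcomp Require Import all_boot all_order all_algebra.
From mathcomp Require Import boolp classical_sets reals topology normedtype.

Set Implicit Arguments.
Unset Strict Implicit.
Unset Printing Implicit Defensive.

Import Order.TTheory GRing.Theory Num.Theory.

Local Open Scope classical_set_scope.
Local Open Scope ring_scope.

Section NormedPlane.
Context {R : realType} {V : normedModType R}.
Implicit Types (x y p q : V) (A G H L : set V) (psi : {scalar V}).

(* [Vector.axiom 2 V] is MathComp's data of a linear bijection V -> 'rV_2; the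
   topology on V is the one induced by its norm. *)
Definition two_dimensional : Prop := inhabited (Vector.axiom 2 V).

Definition bd A : set V := closure A `\` interior A.

Definition unit_ball : set V := [set x : V | `|x| <= 1].

Definition bisector p q : set V := [set z | `|z - p| = `|z - q|].

Definition line x y : set V :=
  [set z | exists l : R, z = l *: y + (1 - l) *: x].

Definition ray x y : set V :=
  [set z | exists2 l : R, 0 <= l & z = l *: y + (1 - l) *: x].

Definition segment x y : set V :=
  [set z | exists2 l : R, 0 <= l <= 1 & z = l *: y + (1 - l) *: x].

Definition strict_pair p q : Prop :=
  ~ exists a b : V,
      [/\ a != b, exists c : R, b - a = c *: (p - q)
        & segment a b `<=` bd unit_ball].

(* [shift v] is the map x |-> x + v. *)
Definition is_translate G A : Prop := exists v : V, G = shift v @` A.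

(* [psi] fixes which side of the line is "above". *)
Definition orientation p q psi : Prop :=
  psi (p - q) = 0 /\ exists v : V, psi v != 0.

(* Meant for translates of the line through p and q: these are the level sets
   of [psi], so that this compares the two values taken by [psi]. *)
Definition above psi G H : Prop :=
  forall x y, G x -> H y -> psi y < psi x.

Definition supporting_line L A : Prop :=
  exists (f : {scalar V}) (c : R),
    [/\ exists v : V, f v != 0,
        L = [set x | f x = c],
        forall x, A x -> f x <= c
      & L `&` A !=set0].

Definition is_L_top psi p q L : Prop :=
  [/\ is_translate L (line p q),
      above psi L (line p q),
      supporting_line L (shift p @` unit_ball)
    & supporting_line L (shift q @` unit_ball)].

(* Weak, so that degenerate segments are allowed. *)
Definition left_of p q x y : Prop :=
  exists2 c : R, 0 <= c & y - x = c *: (q - p).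

End NormedPlane.

Arguments two_dimensional {R} V.

(* Main.v *)
Require Import Defs.
From HB Require Import structures.
From mathcomp Require Import all_boot all_order all_algebra.
From mathcomp Require Import boolp classical_sets reals topology normedtype.
From mathcomp Require Import ring lra.

Set Implicit Arguments.
Unset Strict Implicit.
Unset Printing Implicit Defensive.

Import Order.TTheory GRing.Theory Num.Theory.
Import numFieldNormedType.Exports.

Local Open Scope classical_set_scope.
Local Open Scope ring_scope.

(** Let u = q - p, let h be the height of the top supporting line above the line
    through p and q, measured by psi, and let a = tp - p. The top segments of
    both balls are translates of the same segment {a + r u : 0 <= r <= w}, and
    it is exactly the set of unit vectors of height h, where every vector of
    height h has norm at least 1 ([supporting_level], [top_segmentP]).

    A point at height tau * h above the line is z = p + tau (a + r u), and then
    z - q = tau (a + (r - 1/tau) u). With g r = |a + r u|, it lies on the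
    bisector if and only if g r = g (r - 1/tau). The function g is convex, with
    minimum 1 attained exactly on [0, w]. The rays through tp' and tq' start at
    points that differ by u, and their directions differ by w u, so they meet at
    the height lam * h with lam * w = 1. Hence the heights not above that of s_t
    are those with w <= 1/tau: the shift is at least as long as the flat part
    of g.

    In this situation the equation g r = g (r - d) has exactly one solution
    ([convex_shift_eq]): r must lie to the right of the flat part and r - d to
    the left of it, and there g r - g (r - d) is strictly increasing and changes
    sign. For a shorter shift both points could stay in the flat part, and
    uniqueness would fail. *)

(** * Convex functions with a flat minimum *)

Definition convex_on_line (R : realType) (g : R -> R) : Prop :=
  forall t x y, 0 <= t <= 1 ->
    g (t * x + (1 - t) * y) <= t * g x + (1 - t) * g y.

(** The point x is a convex combination of e and y with a positive weight on e,
    which pulls the value below g y. Both orders of e and y are included, so that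
    this gives strict monotonicity on each side of a minimum. *)
Lemma convex_lt_away (R : realType) (g : R -> R) (e x y : R) :
  convex_on_line g -> g e < g y -> (e <= x < y) || (y < x <= e) -> g x < g y.
Proof.
move=> gconv gey xy.
have ye : y - e != 0.
  by rewrite subr_eq0; apply/eqP => ye; move: xy; rewrite ye; lra.
pose t := (y - x) / (y - e).
have tE : t * (y - e) = y - x by rewrite /t divfK.
have t01 : 0 < t <= 1.
  case/orP: xy => xy.
    have ye0 : 0 < y - e by lra.
    by rewrite /t divr_gt0 ?ler_pdivrMr //; lra.
  have ye0 : 0 < e - y by lra.
  have -> : t = (x - y) / (e - y).
    by rewrite /t -(opprB x y) -(opprB e y) invrN mulrNN.
  by rewrite divr_gt0 ?ler_pdivrMr //; lra.
have := gconv t e y; rewrite (_ : t * e + (1 - t) * y = x); last lra.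
have : 0 < t * (g y - g e) by apply: mulr_gt0; lra.
have : 0 <= t <= 1 by lra.
move=> h01 h /(_ h01); lra.
Qed.

(** When the shift d is at least as long as the flat part, two points at
    distance d with equal values can be neither on the same side of the flat
    part, where g is strictly monotone, nor one inside and one outside of it. So
    they enclose it, which leaves b <= x <= a + d. At the ends of that interval
    one of the two values is the minimum m, so the difference changes sign. *)
Lemma convex_shift_eq (R : realType) (g : R -> R) (m a b d : R) :
  continuous g -> convex_on_line g ->
  (forall x, m <= g x) -> (forall x, g x = m <-> a <= x <= b) ->
  a <= b -> 0 < d -> b - a <= d ->
  exists r, forall x, g x = g (x - d) <-> x = r.
Proof.
move=> gcont gconv gmin gflat ab d0 bad.
have ga : g a = m by apply/gflat; lra.
have gb : g b = m by apply/gflat; lra.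
have gout x : (x < a) || (b < x) -> m < g x.
  move=> xout; rewrite lt_neqAle gmin andbT; apply/eqP => /esym/gflat; lra.
have ginc x y : b <= x -> x < y -> g x < g y.
  by move=> bx xy; apply: (@convex_lt_away _ _ b); rewrite ?gb ?gout //; lra.
have gdec x y : y <= a -> x < y -> g y < g x.
  by move=> bx xy; apply: (@convex_lt_away _ _ a); rewrite ?ga ?gout //; lra.
(* Equality a = x - d, b = x is the only way for both points to lie in the flat
   part, and it satisfies the bounds too. *)
have sol_range x : g x = g (x - d) -> b <= x <= a + d.
  move=> gx; have := gmin x.
  have [xb|bx] := ltP x b; have [dx|xd] := ltP (a + d) x => //=; try lra.
  - have [xa|ax] := ltP x a; first by have := @gdec (x - d) x; lra.
    have := gout (x - d); have : g x = m by apply/gflat; lra.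
    lra.
  - have [xb|bx'] := ltP b (x - d); first by have := @ginc (x - d) x; lra.
    have := gout x; have : g (x - d) = m by apply/gflat; lra.
    lra.
have [r rI r0] : exists2 r, r \in `[b, a + d] & g r - g (r - d) = 0.
  apply: (@IVT _ (fun x => g x - g (x - d))); first lra.
    apply: continuous_subspaceT => x; apply: cvgB; first exact: gcont.
    apply: continuous_comp; last exact: gcont.
    by apply: cvgB; [exact: cvg_id|exact: cvg_cst].
  have := gmin (b - d); have := gmin (a + d).
  rewrite (_ : a + d - d = a); last by ring.
  by move=> ? ?; rewrite ge_min le_max ga gb; lra.
exists r => x; split => [gx|->]; last by move/subr0_eq: r0.
have {}rI : b <= r <= a + d by move: rI; rewrite in_itv.
have := sol_range _ gx => xI; have {}r0 := subr0_eq r0.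
have [xr|rx|//] := ltgtP x r.
- have := @ginc x r; have := @gdec (x - d) (r - d); lra.
- have := @ginc r x; have := @gdec (r - d) (x - d); lra.
Qed.

(** * Norms along a line *)

Lemma bd_unit_ballE (R : realType) (V : normedModType R) :
  bd (@unit_ball R V) = [set x | `|x| = 1].
Proof.
have BE : @unit_ball R V = closed_ball 0 1.
  by rewrite closed_ballE //; apply/seteqP; split=> x;
     rewrite /unit_ball /closed_ball_ /= sub0r normrN.
rewrite /bd BE interior_closed_ballE // -(closure_id _).1; last first.
  exact: closed_ball_closed.
rewrite -BE; apply/seteqP; split=> x /=.
  rewrite /unit_ball -ball_normE /= sub0r normrN => -[x1 /negP].
  by rewrite -leNgt => x1'; apply/eqP; rewrite eq_le x1.
by rewrite /unit_ball -ball_normE /= sub0r normrN => ->; rewrite ltxx.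
Qed.

Lemma convex_norm_line (R : realType) (V : normedModType R) (a u : V) :
  convex_on_line (fun r : R => `|a + r *: u|).
Proof.
move=> t x y t01.
have -> : a + (t * x + (1 - t) * y) *: u =
    t *: (a + x *: u) + (1 - t) *: (a + y *: u).
  by rewrite !scalerDr addrACA -scalerDl subrKC scale1r !scalerA -scalerDl.
apply: (le_trans (ler_normD _ _)).
by rewrite !normrZ !ger0_norm //; lra.
Qed.

Lemma continuous_norm_line (R : realType) (V : normedModType R) (a u : V) :
  continuous (fun r : R => `|a + r *: u|).
Proof.
move=> r; apply: cvg_norm.
by apply: cvgD; [exact: cvg_cst|exact: scalel_continuous].
Qed.

(** * Lines and supporting lines *)

Lemma lineE (R : realType) (V : normedModType R) (p q z : V) :
  line p q z <-> exists r : R, z = p + r *: (q - p).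
Proof.
by split=> -[r ->]; exists r;
   rewrite scalerBr scalerBl scale1r addrCA.
Qed.

Lemma translate_lineP (R : realType) (V : normedModType R) (p q g : V)
    (G : set V) :
  is_translate G (line p q) -> G g ->
  forall z, G z <-> exists r : R, z = g + r *: (q - p).
Proof.
move=> [v ->] [_ /lineE[s ->] <-] z; rewrite /shift /=; split.
  move=> [_ /lineE[r ->] <-]; exists (r - s).
  by rewrite [RHS]addrAC -[in RHS](addrA p) -scalerDl subrKC.
move=> [r ->]; exists (p + (s + r) *: (q - p)).
  by apply/lineE; exists (s + r).
by rewrite scalerDl addrA [LHS]addrAC.
Qed.

(** The supporting functional f and psi have the same kernel, so they are
    proportional, and the bound of f on the unit ball carries over to psi.
    That ker psi is spanned by q - p holds because the level set of f at c is by
    assumption a single translate of the line through p and q. *)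
Lemma supporting_level (R : realType) (V : normedModType R) (p q : V)
    (psi : {scalar V}) (L : set V) :
  psi (p - q) = 0 -> is_translate L (line p q) -> above psi L (line p q) ->
  supporting_line L (shift p @` unit_ball) ->
  exists h : R, [/\ 0 < h, L = [set x | psi x = psi p + h],
    forall x, psi x <= h * `|x|
  & forall x, psi x = 0 -> exists r, x = r *: (q - p)].
Proof.
move=> psiu Ltr Lab [f [c [_ LE fB [y [Ly _]]]]].
set u := q - p.
have psiu0 : psi u = 0 by move: psiu; rewrite /u !raddfB /= => ?; lra.
have [b yE] : exists b, y = p + b by exists (y - p); rewrite subrKC.
have Lline := translate_lineP Ltr Ly.
have fy : f y = c by move: Ly; rewrite LE.
have fu : f u = 0.
  have : L (y + 1 *: u) by apply/Lline; exists 1.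
  by rewrite LE /= scale1r raddfD /= fy => ?; lra.
have kerf x : f x = 0 -> exists r, x = r *: u.
  move=> fx; have /Lline[r /addrI ->] : L (y + x).
    by rewrite LE /= raddfD /= fx fy addr0.
  by exists r.
have kerf_psi x : f x = 0 -> psi x = 0.
  by move=> /kerf[r ->]; rewrite scalarZ /= psiu0 mulr0.
have psib : 0 < psi b.
  have : psi p < psi y.
    by apply: Lab => //; apply/lineE; exists 0; rewrite scale0r addr0.
  by rewrite yE raddfD ltrDl.
(* p + b lies on the supporting line, so f b bounds f on the unit ball. *)
have fball x : `|x| <= 1 -> f x <= f b.
  move=> x1; have : f (x + p) <= c by apply: fB; exists x.
  by rewrite -fy yE !raddfD /=; lra.
have fb : 0 < f b.
  rewrite lt_neqAle -[X in X <= _](raddf0 f) fball ?normr0 // andbT.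
  by apply/eqP => /esym/kerf_psi fb0; move: psib; rewrite fb0 ltxx.
have propor x : psi x * f b = psi b * f x.
  have /kerf_psi : f (f x *: b - f b *: x) = 0.
    by rewrite raddfB /= !scalarZ; ring.
  by rewrite raddfB /= !scalarZ /= => ?; lra.
exists (psi b); split=> //.
- rewrite LE -fy; apply/seteqP; split=> x /=.
    move=> fx; have : f (x - y) = 0 by rewrite raddfB /= fx subrr.
    by move/kerf_psi; rewrite yE raddfB raddfD /= => ?; lra.
  have := propor (x - y); rewrite yE !raddfB !raddfD /= => + px.
  rewrite px (_ : _ + _ = 0); last by ring.
  by rewrite mul0r => /esym/eqP; rewrite mulf_eq0 gt_eqF //= => /eqP ?; lra.
- move=> x; have [->|x0] := eqVneq x 0; first by rewrite raddf0 normr0 mulr0.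
  have nx : 0 < `|x| by rewrite normr_gt0.
  have : f (`|x|^-1 *: x) <= f b.
    by apply: fball; rewrite normrZ normfV normr_id mulVf // gt_eqF.
  rewrite scalarZ /= ler_pdivrMl // => fx.
  rewrite -(ler_pM2r fb) propor mulrAC -mulrA ler_pM2l //.
  by rewrite mulrC in fx; lra.
- move=> x px; apply: kerf; have := propor x.
  by rewrite px mul0r => /esym/eqP; rewrite mulf_eq0 gt_eqF //= => /eqP.
Qed.

(** Taking the left endpoint t as origin makes the vectors t - m comparable for
    the two centres m = p and m = q: each is the left end of the same set of unit
    vectors. The case w = 0 is a top segment reduced to a point. *)
Lemma top_segmentP (R : realType) (V : normedModType R) (p q m t t' : V)
    (psi : {scalar V}) (h : R) (L : set V) :
  p != q -> psi (q - p) = 0 -> L = [set x | psi x = psi m + h] ->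
  L `&` (shift m @` bd unit_ball) = segment t t' -> left_of p q t t' ->
  psi (t - m) = h /\ exists w : R, [/\ 0 <= w, t' = t + w *: (q - p)
  & forall r, `|t - m + r *: (q - p)| = 1 <-> 0 <= r <= w].
Proof.
rewrite eq_sym -subr_eq0; set u := q - p => u0 psiu LE segE [w w0 tt'].
have t'E : t' = t + w *: u by rewrite -tt' subrKC.
clearbody u; clear tt'.
have segP z : segment t t' z <-> exists2 l, 0 <= l <= 1 & z = t + (l * w) *: u.
  by split=> -[l l01 ->]; exists l => //;
    rewrite t'E scalerDr scalerA addrAC -scalerDl subrKC scale1r.
have psit : psi (t - m) = h.
  have : segment t t' t.
    by apply/segP; exists 0; rewrite ?mul0r ?scale0r ?addr0 //; lra.
  by rewrite -segE LE => -[/= pt _]; rewrite raddfB /= pt addrC addKr.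
split=> //; exists w; split=> // r.
have -> : `|t - m + r *: u| = 1 <-> segment t t' (t + r *: u).
  rewrite -segE LE bd_unit_ballE; split.
    move=> n1; split=> /=.
      by rewrite raddfD /= scalarZ psiu mulr0 addr0 -psit raddfB /= subrKC.
    by exists (t - m + r *: u) => //; rewrite /shift /= addrAC subrK.
  by move=> [_ [x /= nx xE]]; rewrite addrAC -xE /shift /= addrK.
rewrite segP; split.
  move=> [l l01 /addrI/eqP].
  rewrite -subr_eq0 -scalerBl scaler_eq0 (negPf u0) orbF.
  rewrite subr_eq0 => /eqP ->; nra.
move=> rw; have [w00|wn0] := eqVneq w 0.
  by exists 0; [lra|rewrite mul0r (_ : r = 0) //; lra].
exists (r / w); last by rewrite divfK.
have wp : 0 < w by lra.
by rewrite divr_ge0 ?ler_pdivrMr //; lra.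
Qed.

Theorem proposition2p3 (R : realType) (V : normedModType R)
    (dimV : two_dimensional V)
    (p q : V) (pq : p != q) (nonstrict : ~ strict_pair p q)
    (psi : {scalar V}) (psiP : orientation p q psi)
    (L_top : set V) (L_topP : is_L_top psi p q L_top)
    (tp tp' : V) (tpP : L_top `&` (shift p @` bd unit_ball) = segment tp tp')
    (tp_left : left_of p q tp tp')
    (tq' tq : V) (tqP : L_top `&` (shift q @` bd unit_ball) = segment tq' tq)
    (tq_left : left_of p q tq' tq)
    (st : V) (stP : ray p tp' `&` ray q tq' = [set st])
    (G_t : set V) (G_tP : is_translate G_t (line p q)) (G_t_st : G_t st) :
  forall G : set V,
    is_translate G (line p q) ->
    above psi G (line p q) ->
    ~ above psi G G_t ->
    exists z : V, G `&` bisector p q = [set z].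
Proof.
move=> G Gtr Gab Gnab.
have [psipq _] := psiP; have [Ltr Lab Lp _] := L_topP.
have [h [h0 LE psi_le kerpsi]] := supporting_level psipq Ltr Lab Lp.
have psiqp : psi (q - p) = 0.
  by move: psipq; rewrite !raddfB /= => ?; lra.
have psiqE : psi q = psi p by move: psipq; rewrite raddfB => ?; lra.
have LEq : L_top = [set x | psi x = psi q + h] by rewrite psiqE.
have [psia [w [w0 tp'E flatp]]] := top_segmentP pq psiqp LE tpP tp_left.
have [psia' [w' [w'0 _ flatq]]] := top_segmentP pq psiqp LEq tqP tq_left.
set u := q - p in psiqp kerpsi tp'E flatp flatq.
have u0 : u != 0 by rewrite subr_eq0 eq_sym.
have qE : q = p + u by rewrite subrKC.
have uE : q - p = u by [].
set a := tp - p in psia flatp; have tpE : tp = p + a by rewrite subrKC.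
clearbody u a.
(* Both are the left end of the set of unit vectors of height h: they differ by
   some k u, where k >= 0 and - k >= 0. *)
have tq'E : tq' - q = a.
  have [k kE] : exists k, tq' - q - a = k *: u.
    by apply: kerpsi; rewrite raddfB /= psia psia' subrr.
  have {}kE : tq' - q = a + k *: u by rewrite -kE subrKC.
  have : `|tq' - q + 0 *: u| = 1 by apply/flatq; lra.
  have : `|a + 0 *: u| = 1 by apply/flatp; lra.
  rewrite (_ : a + 0 *: u = tq' - q + (- k) *: u); last first.
    by rewrite kE scaleNr addrK scale0r addr0.
  move=> /flatq k1; rewrite scale0r addr0 kE => /flatp k2.
  by rewrite (_ : k = 0) ?scale0r ?addr0 //; lra.
(* Both rays reach s_t with the same parameter, since they rise at the same
   rate h; subtracting the two expressions of s_t gives lam w u = u. *)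
have [lam lam0 [stE lamw]] : exists2 lam, 0 <= lam &
    psi st = psi p + lam * h /\ lam * w = 1.
  have : (ray p tp' `&` ray q tq') st by rewrite stP.
  move=> [[lam lam0 stE] [mu mu0 stE']]; exists lam => //.
  have {}stE : st = p + lam *: (a + w *: u).
    by rewrite stE tp'E tpE -addrA scalerDr scalerBl scale1r addrAC subrKC.
  have {}stE' : st = p + (u + mu *: a).
    rewrite stE' -[tq'](subrKC q) tq'E scalerDr scalerBl scale1r.
    by rewrite addrAC subrKC qE -addrA.
  have psist : psi st = psi p + lam * h.
    rewrite stE raddfD /= scalarZ raddfD /= scalarZ /=.
    by rewrite psiqp psia mulr0 addr0.
  have : psi st = psi p + mu * h.
    by rewrite stE' !raddfD /= scalarZ /= psiqp psia add0r.
  rewrite psist => /addrI/(mulIf (lt0r_neq0 h0)) lammu; split=> //.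
  move: stE'; rewrite -lammu stE scalerDr addrC [in RHS]addrC => /addIr.
  rewrite addrC => /addIr /eqP; rewrite scalerA -subr_eq0.
  rewrite -[X in _ - X]scale1r -scalerBl scaler_eq0 (negPf u0) orbF subr_eq0.
  by move=> /eqP.
have lamgt0 : 0 < lam.
  rewrite lt_neqAle lam0 andbT; apply/eqP => l0.
  by move: lamw; rewrite -l0; lra.
have [g [Gg [tau tauE gE]]] : exists g, G g /\ exists2 tau,
    psi g = psi p + tau * h & 0 < tau <= lam.
  have [x [y [Gx Gty xy]]] : exists x y, [/\ G x, G_t y & psi x <= psi y].
    apply: contrapT => nxy; apply: Gnab => x y Gx Gy.
    rewrite ltNge; apply/negP => xy.
    by apply: nxy; exists x, y.
  have /(translate_lineP G_tP G_t_st)[r yE] := Gty.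
  move: xy; rewrite yE raddfD /= scalarZ uE psiqp mulr0 addr0 stE => xy.
  exists x; split=> //; exists ((psi x - psi p) / h).
    by rewrite divfK ?subrKC // gt_eqF.
  rewrite divr_gt0 ?subr_gt0 ?ler_pdivrMr ?lerBlDl //.
  by apply: Gab => //; apply/lineE; exists 0; rewrite scale0r addr0.
case/andP: gE => tau0 taulam.
have taun0 : tau != 0 by rewrite gt_eqF.
have GE z : G z <-> exists r, z = p + tau *: (a + r *: u).
  have [k gE] : exists k, g - (p + tau *: a) = k *: u.
    by apply: kerpsi; rewrite raddfB raddfD /= scalarZ /= tauE psia subrr.
  have {}gE : g = p + tau *: a + k *: u by rewrite -gE subrKC.
  apply: iff_trans (translate_lineP Gtr Gg z) _; rewrite uE.
  split=> -[r ->].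
    exists ((k + r) / tau).
    by rewrite gE -[LHS]addrA -scalerDl scalerDr scalerA mulrC divfK // addrA.
  exists (tau * r - k).
  by rewrite gE -[RHS]addrA -scalerDl subrKC scalerDr scalerA addrA.
have norm_ge1 r : 1 <= `|a + r *: u|.
  have := psi_le (a + r *: u).
  by rewrite raddfD /= scalarZ /= psiqp mulr0 addr0 psia ler_pMr.
have bisE r : bisector p q (p + tau *: (a + r *: u)) <->
    `|a + r *: u| = `|a + (r - tau^-1) *: u|.
  rewrite /bisector /= addrAC subrr add0r.
  have -> : p + tau *: (a + r *: u) - q = tau *: (a + (r - tau^-1) *: u).
    rewrite scalerBl addrA scalerBr scalerA divff // scale1r.
    by rewrite qE opprD addrACA subrr add0r.
  rewrite !normrZ; split=> [|-> //].
  by apply: mulfI; rewrite normr_eq0.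
have wtau : w - 0 <= tau^-1.
  rewrite subr0 -[leRHS]mul1r ler_pdivlMr //.
  by rewrite -lamw mulrC ler_wpM2r.
have tauV0 : 0 < tau^-1 by rewrite invr_gt0.
have [r rP] := convex_shift_eq (@continuous_norm_line _ _ a u)
  (convex_norm_line a u) norm_ge1 flatp w0 tauV0 wtau.
exists (p + tau *: (a + r *: u)); apply/seteqP; split=> z /=.
  by move=> [/GE[s ->] /bisE/rP ->].
by move=> ->; split; [apply/GE; exists r|apply/bisE/rP].
Qed.
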